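(* Let $G=(V,E)$ be a simple undirected graph and let $M, N \subseteq E$ be two triangle-free $2$-matchings of $G$. Then the edge set $M \oplus N = (M\setminus N)\cup(N\setminus M)$ can be partitioned into $M$-alternating paths and $M$-alternating cycles such that each of these paths and cycles is amenable with respect to $M$.
   Context: A $2$-matching of $G$ is a set $F\subseteq E$ such that every vertex is incident to at most two edges of $F$; it is triangle-free if it contains no cycle of length three (triangle). A path is a sequence of vertices $(v_0,\dots,v_l)$, $l\ge 1$, with $(v_i,v_{i+1})\in E$; paths and cycles are treated as edge sets or as sequences of edges. An $M$-alternating path is a vertex sequence $(v_1,\dots,v_k)$ whose consecutive edges are alternately in $M$ and not in $M$, and in which no edge occurs more than once (vertices may repeat, via different edges). An $M$-alternating cycle is defined in the same way except that $v_1=v_k$ and additionally $(v_{k-1},v_k)\in M$ iff $(v_1,v_2)\notin M$. An $M$-alternating path or cycle $P$ is amenable with respect to $M$ if for every triangle $t$ of $G$ all of whose edges lie in $M\cup P$, some two edges of $t$ are consecutive on $P$. *)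

(* Defs.v *)
From mathcomp Require Import all_boot.

Set Implicit Arguments.
Unset Strict Implicit.
Unset Printing Implicit Defensive.

(* A finite simple graph on T is given by a symmetric irreflexive adjacency
   relation g : rel T; an edge is the 2-element set of its endpoints. *)

Section Graph.

Variable (T : finType) (g : rel T).
Implicit Types (x y z v : T) (e f a b : {set T}) (p : seq T).
Implicit Types (F M t : {set {set T}}).

Definition edges : {set {set T}} :=
  [set [set xy.1; xy.2] | xy : T * T & g xy.1 xy.2].

Definition two_matching F : Prop :=
  F \subset edges /\ forall v, #|[set e in F | v \in e]| <= 2.

(* For an irreflexive g the three vertices are automatically distinct. *)
Definition triangle t : Prop :=
  exists x y z, [/\ g x y, g y z, g z x &
    t = [set [set x; y]; [set y; z]; [set z; x]]].

Definition triangle_free F : Prop :=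
  forall t, triangle t -> ~~ (t \subset F).

Definition tf_two_matching F : Prop := two_matching F /\ triangle_free F.

(* The edges {v_1, v_2}, ..., {v_(k-1), v_k} of p = (v_1, ..., v_k), in order. *)
Definition steps p : seq {set T} :=
  if p is x :: p' then pairmap (fun u v => [set u; v]) x p' else [::].

(* sorted is used for "r holds between consecutive items"; neither g nor the
   alternation relation is transitive. *)
Definition alternating_path M p : bool :=
  [&& 1 < size p, sorted g p, uniq (steps p)
    & sorted (fun e f => (e \in M) != (f \in M)) (steps p)].

(* A cycle (v_1, ..., v_k) repeats its base vertex: v_k = v_1. The predicate
   cycle adds to sorted the condition between the last and the first edge. *)
Definition alternating_cycle M p : bool :=
  [&& alternating_path M p, (if p is x :: p' then last x p' == x else false)
    & cycle (fun e f => (e \in M) != (f \in M)) (steps p)].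

Definition consecutive (s : seq {set T}) a b : bool :=
  infix [:: a; b] s || infix [:: b; a] s.

(* On a cycle the last edge is also followed by the first one. *)
Definition cyclically_consecutive (s : seq {set T}) a b : bool :=
  if s is e :: _ then consecutive (rcons s e) a b else false.

Definition amenable_for (consec : rel {set T}) M p : Prop :=
  forall t, triangle t -> t \subset M :|: [set:: steps p] ->
    exists a b, [/\ a \in t, b \in t, a != b & consec a b].

Definition amenable_path M p : Prop :=
  amenable_for (consecutive (steps p)) M p.

Definition amenable_cycle M p : Prop :=
  amenable_for (cyclically_consecutive (steps p)) M p.

End Graph.

(* Main.v *)
Require Import Defs.
From mathcomp Require Import all_boot.
From mathcomp Require Import zify.

(** Colour the edges of [M :\: N], [N :\: M] and [M :&: N] as M, N and C. A set
    of links, each pairing an M-edge with an N-edge at a common endpoint,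
      no edge
    being linked twice at the same endpoint, splits the symmetric difference
    into alternating trails. A triangle with colours M, N, C can only be served
    by the corner between its M- and its N-edge;
      in every other relevant triangle
    the two edges of equal colour ("legs") meet the third one (the "base") in
      two
    corners, one at each end of the base, and linking one of them is enough.
    Corners compete only in few ways, so that a local rule chooses one corner
    per triangle without conflict, unless five vertices carry a pentagon of one
    colour and at least four edges of the complementary pentagon in the other.
    There the corners of the triangles form an odd cycle of conflicts and no
    choice works. But such a five-vertex configuration shares no triangle with
    the rest, and its edges form three amenable trails: the two N-edges of a
    triangle without a linked corner fall in different trails. *)

Set Implicit Arguments.
Unset Strict Implicit.
Unset Printing Implicit Defensive.

(** * Choosing a corner for every triangle *)

Section Pick.

Variable T : finType.
Implicit Types (a b c : rel T) (u v w x y z : T).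

(* Here [a] and [b] are the two colours of the symmetric difference, in either
   order, and [c] is the common colour. The triangle with base [uv] of colour
   [a] and apex [x] is encoded as [u v x], where [u] is the end of the base
   under scrutiny. It is blocked at [u] if its base is also a leg at [u] of a
   triangle with base [uy], or if the corner of [uv] and [uy] is forced by a
   triangle with third edge in [c]. It leans at [u] if it blocks in this way the
   triangle with base [ux] and apex [z]. Its mate is the other triangle with the
   same base. *)
Definition blocked a b c u v x :=
  [exists y, [&& y != x, b u y & a v y || c v y]].
Definition knotted a b u v x := [exists y, [&& b u y, a v y & a x y]].
Definition leaning a u v x := [exists z, [&& z != v, a u z & a x z]].
Definition mate_leaning a b u v x :=
  [exists y, [&& y != x, b u y, b v y & leaning a u v y]].

(* The weights make the comparison of scores lexicographic. *)
Definition score a b c u v x : nat :=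
  ~~ blocked a b c u v x * 8 + ~~ knotted a b u v x * 4
  + ~~ leaning a u v x * 2 + mate_leaning a b u v x.

Definition mate_before b u v x :=
  [exists y, [&& y != x, b u y, b v y & enum_rank y < enum_rank x]].

(* [pick a b c u v x] selects the end [u] of the base, hence the corner of [uv]
   and [ux]. The ranks only serve to send two mates to opposite ends. *)
Definition pick a b c u v x :=
  (score a b c v u x < score a b c u v x) ||
  (score a b c v u x == score a b c u v x) &&
  ((enum_rank u < enum_rank v) (+) mate_before b u v x).

(* At [v] the [a]-edge [vu] is linked to the [b]-edge [vw]. *)
Definition linked a b c v u w :=
  [&& a v u, b v w
    & [|| c u w, a u w && pick b a c v w u | b u w && pick a b c v u w]].

Lemma mate_beforeC b u v x : mate_before b u v x = mate_before b v u x.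
Proof.
by apply: eq_existsb => y; rewrite (andbCA (b u y)).
Qed.

(** On equal scores, swapping the ends flips the rank comparison but not [mate_before], so exactly
    one of the two exclusive ors is true. *)
Lemma pick_total a b c u v x : u != v -> pick a b c u v x || pick a b c v u x.
Proof.
move=> neq_uv; rewrite /pick mate_beforeC.
case: ltngtP => //= _.
have : enum_rank u != enum_rank v by rewrite (inj_eq enum_rank_inj).
rewrite -(inj_eq val_inj) /= neq_ltn.
by case: ltngtP => //=; case: mate_before.
Qed.

(** A knotting vertex differs from [x] because [a] is irreflexive, hence it blocks as well. The
    knotted bit thus matters only at blocked ends. *)
Lemma unblocked_knotted a b c u v x : irreflexive a ->
  blocked a b c u v x = false -> knotted a b u v x = false.
Proof.
move=> airr; apply: contraFF => /existsP[y /and3P[uy vy xy]].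
apply/existsP; exists y; rewrite uy vy andbT.
by apply: contraTneq xy => ->; rewrite airr.
Qed.

(** * Conflicts between picked corners *)

Section Functional.

Variables a b c : rel T.
Hypotheses (aC : symmetric a) (bC : symmetric b).
Hypotheses (airr : irreflexive a) (birr : irreflexive b).
Hypothesis abF : forall u v, a u v -> b u v = false.
Hypothesis bcF : forall u v, b u v -> c u v = false.
Hypothesis deg_ac : forall u x y z, a u x || c u x -> a u y || c u y ->
  a u z || c u z -> [|| x == y, y == z | x == z].
Hypothesis deg_bc : forall u x y z, b u x || c u x -> b u y || c u y ->
  b u z || c u z -> [|| x == y, y == z | x == z].
Hypothesis no_pentagon : forall u v x y z,
  a u v -> a v y -> a y x -> a x z -> a z u ->
  b u x -> b v x -> b u y -> b v z -> False.

Lemma ac_neighbour u x y z : x != y -> a u x || c u x -> a u y || c u y ->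
  a u z || c u z -> z = x \/ z = y.
Proof.
move=> nxy ax ay az; have := deg_ac ax ay az.
by rewrite (negPf nxy) /= => /orP[]/eqP->; [right|left].
Qed.

Lemma bc_neighbour u x y z : x != y -> b u x || c u x -> b u y || c u y ->
  b u z || c u z -> z = x \/ z = y.
Proof.
move=> nxy ax ay az; have := deg_bc ax ay az.
by rewrite (negPf nxy) /= => /orP[]/eqP->; [right|left].
Qed.

Lemma neq_ab u x y : a u x -> b u y -> x != y.
Proof. by move=> ux uy; apply/eqP => e; rewrite -e (abF ux) in uy. Qed.

Lemma neq_a u v : a u v -> u != v.
Proof. by move=> uv; apply/eqP => e; rewrite e airr in uv. Qed.
Lemma neq_b u v : b u v -> u != v.
Proof. by move=> uv; apply/eqP => e; rewrite e birr in uv. Qed.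

(** The vertex [u] has no [b]- or [c]-neighbours besides [x] and [y], so only [y] could block; but
    [vy] has colour [b]. *)
Lemma mates_unblocked u v x y : a u v -> b u x -> b v x -> b u y -> b v y ->
  x != y -> blocked a b c u v x = false.
Proof.
move=> uv ux vx uy vy nxy; apply/negbTE/negP => /existsP[w /and3P[nwx uw vw]].
have [] := @bc_neighbour u x y w; rewrite ?ux ?uy ?uw //.
  by move/eqP; rewrite (negPf nwx).
by move=> e; move: vw; rewrite e orbC (bcF vy) /= => /abF; rewrite vy.
Qed.

(** Both leans would use the second [a]-neighbour [z] of [u], and [z] would have three
    [a]-neighbours [u], [x], [y]. *)
Lemma mates_leaning u v x y : a u v -> b u x -> b u y -> x != y ->
  leaning a u v x -> leaning a u v y -> False.
Proof.
move=> uv ux uy nxy /existsP[z /and3P[nzv uz xz]] /existsP[w /and3P[nwv uw yw]].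
have ezw : w = z.
  have [] := @ac_neighbour u v z w; rewrite ?uv ?uz ?uw // 1?eq_sym //.
  by move/eqP; rewrite (negPf nwv).
subst w; have [] := @ac_neighbour z x y u; rewrite ?(aC z) ?xz ?yw ?uz //.
  by move/eqP; rewrite (negPf (neq_b ux)).
by move/eqP; rewrite (negPf (neq_b uy)).
Qed.

Lemma mate_leaningE u v x y : b u x -> b v x -> b u y -> b v y -> x != y ->
  mate_leaning a b u v x = leaning a u v y.
Proof.
move=> ux vx uy vy nxy; apply/existsP/idP => [[w /and4P[nwx uw vw lw]]|ly].
  have [] := @bc_neighbour u x y w; rewrite ?ux ?uy ?uw //.
    by move/eqP; rewrite (negPf nwx).
  by move=> <-.
by exists y; rewrite uy vy ly eq_sym nxy.
Qed.

Lemma mate_beforeE u v x y : b u x -> b v x -> b u y -> b v y -> x != y ->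
  mate_before b u v x = (enum_rank y < enum_rank x).
Proof.
move=> ux vx uy vy nxy; apply/existsP/idP => [[w /and4P[nwx uw vw lw]]|ly].
  have [] := @bc_neighbour u x y w; rewrite ?ux ?uy ?uw //.
    by move/eqP; rewrite (negPf nwx).
  by move=> <-.
by exists y; rewrite uy vy ly eq_sym nxy.
Qed.

(** Mates are never blocked and do not both lean at one end, so only the last two bits vary, with
    sum 0, 2 or 3. Exchanging the mates swaps 0 and 3, which reverses any strict comparison of the
    ends; on ties [mate_before] differs for the two mates. *)
Lemma pick_mates u v x y : a u v -> b u x -> b v x -> b u y -> b v y ->
  x != y -> pick a b c u v x -> pick a b c u v y -> False.
Proof.
move=> uv ux vx uy vy nxy.
have vu : a v u by rewrite aC.
have nyx : y != x by rewrite eq_sym.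
rewrite /pick /score.
rewrite !(@unblocked_knotted a b c _ _ x) ?(@unblocked_knotted a b c _ _ y);
  rewrite ?(@mates_unblocked _ _ x y) ?(@mates_unblocked _ _ y x) //.
rewrite !(@mate_leaningE _ _ x y) ?(@mate_leaningE _ _ y x) //.
rewrite !(@mate_beforeE _ _ x y) ?(@mate_beforeE _ _ y x) //.
have := @mates_leaning u v x y uv ux uy nxy.
have := @mates_leaning v u x y vu vx vy nxy.
have : enum_rank x != enum_rank y by rewrite (inj_eq enum_rank_inj).
rewrite -(inj_eq val_inj) /=.
do 4![case: leaning]; case: (ltngtP (enum_rank x)) => //= _ _;
 case: (enum_rank u < enum_rank v) => //=; by do ?[move=> /(_ isT isT)].
Qed.

(** The vertex [y] blocks [u], while nothing blocks [v], whose only neighbour besides [x] in [b] or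
    [c] is [y], by a [c]-edge. So [v] has the larger score. *)
Lemma pick_forced u v x y : a u v -> b u x -> b v x -> b u y -> c v y ->
  pick a b c u v x = false.
Proof.
move=> uv ux vx uy vy.
have nyx : y != x by apply: contraL vy => /eqP->; rewrite (bcF vx).
have bu : blocked a b c u v x.
  by apply/existsP; exists y; rewrite nyx uy vy orbT.
have bv : blocked a b c v u x = false.
  apply/negbTE/negP => /existsP[w /and3P[nwx vw _]].
  have [] := @bc_neighbour v x y w; rewrite ?vx ?vy ?vw ?orbT // 1?eq_sym //.
    by move/eqP; rewrite (negPf nwx).
  by move=> e; move: vy; rewrite -e (bcF vw).
rewrite /pick /score bu bv (unblocked_knotted airr bv) /=.
by case: knotted; do 2!case: leaning; do 2!case: mate_leaning.
Qed.

(* The two picks compete at [u] for the edge [uv]. If the first triangle is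
   blocked at both ends, by [y] and [z], the absence of pentagons excludes
   [a x y && a x z],
     and a missing edge [xy] sends the blocking triangle to [y]. *)
Lemma pick_competing u v x y : a u v -> b u x -> b v x -> b u y -> a v y ->
  pick a b c u v x -> pick b a c u y v -> False.
Proof.
move=> uv ux vx uy vy.
have nyx : y != x by apply: neq_ab vy vx.
have bu : blocked a b c u v x.
  by apply/existsP; exists y; rewrite nyx uy vy.
case bv : (blocked a b c v u x); last first.
  rewrite /pick /score bu bv (unblocked_knotted airr bv) /=.
  by case: knotted; do 2!case: leaning; do 2!case: mate_leaning.
case/existsP: bv (bv) => z /and3P[nzx vz uz'] bv.
have uz : a u z.
  case/orP: uz' => // uz; have [] := @bc_neighbour u x y z;
    rewrite ?ux ?uy ?uz ?orbT // 1?eq_sym //.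
    by move/eqP; rewrite (negPf nzx).
  by move=> e; rewrite e (bcF uy) in uz.
have nzv : z != v by rewrite eq_sym (neq_b vz).
have nyu : y != u by rewrite eq_sym (neq_b uy).
have ku : knotted a b u v x = a x y.
  apply/existsP/idP => [[w /and3P[uw vw xw]]|xy]; last by exists y;
    rewrite uy vy.
  have [] := @ac_neighbour v u y w; rewrite 1?(aC v u) ?uv ?vw ?vy //.
  - by rewrite eq_sym.
  - by move=> e; rewrite e birr in uw.
  by move=> <-.
have kv : knotted a b v u x = a x z.
  apply/existsP/idP => [[w /and3P[vw uw xw]]|xz]; last by exists z;
    rewrite vz uz.
  have [] := @ac_neighbour u v z w; rewrite ?uv ?uw ?uz //.
  - by rewrite eq_sym.
  - by move=> e; rewrite e birr in vw.
  by move=> <-.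
case xy : (a x y).
  have xz : a x z = false.
    apply/negbTE/negP => xz; apply: (@no_pentagon u v x y z) => //.
    - by rewrite aC.
    - by rewrite aC.
  (* Both ends are blocked but only [u] is knotted, so the bit of weight 4 sends the first triangle
     to [v]. *)
  rewrite /pick /score bu bv ku kv xy xz /=.
  by do 2!case: leaning; do 2!case: mate_leaning.
move=> _.
have bu' : blocked b a c u y v = b y z || c y z.
  apply/existsP/idP => [[w /and3P[nwv uw yw]]|yz]; last first.
    by exists z; rewrite nzv uz yz.
  have [] := @ac_neighbour u v z w; rewrite ?uv ?uw ?uz //.
  - by rewrite eq_sym.
  - by move/eqP; rewrite (negPf nwv).
  by move=> <-.
(* The missing edge [xy] enters here: [x] is the only candidate for blocking the second triangle at
   [y]. *)
have by' : blocked b a c y u v = false.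
  apply/negbTE/negP => /existsP[w /and3P[nwv yw uw]].
  have [] := @bc_neighbour u x y w; rewrite ?ux ?uy // 1?eq_sym //.
  - by move=> e; rewrite -e aC yw in xy.
  - by move=> e; rewrite e airr in yw.
have lu : leaning b u y v by apply/existsP; exists x; rewrite ux vx eq_sym nyx.
have ly : leaning b y u v -> b y z.
  case/existsP => w /and3P[nwu yw vw].
  have [] := @bc_neighbour v x z w; rewrite ?vx ?vz ?vw // 1?eq_sym //;
    last by move<-.
  move=> e; subst w; have [] := @bc_neighbour x u v y;
    rewrite ?(bC x) ?ux ?vx ?yw //.
  - exact: neq_a.
  - by move/eqP; rewrite (negPf nyu).
  by move=> e; rewrite e airr in vy.
(* If [yz] is in [b] or [c], only [u] is blocked. Otherwise neither end is, and only [u] leans.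
   Either way [y] scores more than [u]. *)
case yz : (b y z || c y z); rewrite /pick /score bu' by' yz lu.
  rewrite (unblocked_knotted birr by') /=.
  by case: knotted; do 2!case: leaning; do 2!case: mate_leaning.
rewrite (unblocked_knotted birr by') (@unblocked_knotted b a c u y v) ?bu' //.
case: leaning ly => [/(_ isT)|_]; first by move=> e; rewrite e in yz.
by do 2!case: mate_leaning.
Qed.

(** If neither link comes from a triangle with base [vu], then [u] has three neighbours [v], [w],
    [w'] in [a] or [c]. Otherwise a pick on the base [vu] meets a forced corner, a competing pick or
    the pick of its mate, and the three preceding lemmas apply. *)
Lemma linked_inj v u w w' : linked a b c v u w -> linked a b c v u w' -> w = w'.
Proof.
case/and3P=> vu vw Ew /and3P[_ vw' Ew']; apply/eqP/negPn/negP => nww.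
have uv : a u v by rewrite aC.
have [nwv nwv'] : w != v /\ w' != v by rewrite !(eq_sym _ v) !neq_b.
have two : a u w || c u w -> a u w' || c u w' -> False.
  move=> uw uw'; have [] := @ac_neighbour u w w' v; rewrite ?uv //.
    by move/eqP; rewrite eq_sym (negPf nwv).
  by move/eqP; rewrite eq_sym (negPf nwv').
have bpick x x' : b v x -> b v x' -> b u x && pick a b c v u x ->
    [|| c u x', a u x' && pick b a c v x' u | b u x' && pick a b c v u x'] ->
    x != x' -> False.
  move=> vx vx' /andP[ux px] /or3P[ux'|/andP[ux' px']|/andP[ux' px']] nxx.
  - by rewrite (@pick_forced v u x x') in px.
  - exact: (@pick_competing v u x x').
  - exact: (@pick_mates v u x x').
case/or3P: (Ew) => [uw|/andP[uw _]|pw]; last exact: (bpick w w').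
all: case/or3P: (Ew') => [uw'|/andP[uw' _]|pw'];
  last by (apply: (bpick w' w); rewrite // eq_sym).
all: by apply: two; rewrite ?uw ?uw' ?orbT.
Qed.

End Functional.
End Pick.

(** * Maximal trails of a system of links *)

Lemma set2_inj (T : finType) (a b c d : T) : [set a; b] = [set c; d] ->
  (a = c /\ b = d) \/ (a = d /\ b = c).
Proof.
move=> E.
have : a \in [set c; d] by rewrite -E set21.
have : b \in [set c; d] by rewrite -E set22.
have : c \in [set a; b] by rewrite E set21.
have : d \in [set a; b] by rewrite E set22.
rewrite !inE.
by move=> /orP[]/eqP e1 /orP[]/eqP e2 /orP[]/eqP e3 /orP[]/eqP e4;
  first [by left; split; congruence | by right; split; congruence].
Qed.

Section Trails.

Variable T : finType.
Implicit Types (u v w x : T) (p : seq T) (D : {set {set T}}).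

Lemma size_steps p : size (steps p) = (size p).-1.
Proof. by case: p => //= x p; rewrite size_pairmap. Qed.

Lemma nth_steps x0 e0 p i : i.+1 < size p ->
  nth e0 (steps p) i = [set nth x0 p i; nth x0 p i.+1].
Proof. by case: p => //= x p ltip; rewrite (nth_pairmap x0). Qed.

Lemma steps_rev p : steps (rev p) = rev (steps p).
Proof.
case: p => // x0 p; set q := x0 :: p.
apply: (@eq_from_nth _ set0) => [|i]; rewrite size_steps size_rev.
  by rewrite size_rev size_steps.
move=> lti; have lt1 : i.+1 < size q by rewrite -ltn_predRL.
rewrite (nth_steps x0) ?size_rev // !(nth_rev x0) ?(ltnW lt1) //.
rewrite nth_rev size_steps // (nth_steps x0); last first.
  by rewrite -ltn_predRL ltn_subrL (leq_trans _ lti).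
rewrite setUC; congr [set nth _ _ _; nth _ _ _]; lia.
Qed.

Lemma infix2_nth (S : eqType) (e0 : S) s i : i.+1 < size s ->
  infix [:: nth e0 s i; nth e0 s i.+1] s.
Proof.
move=> lti; apply/infixP; exists (take i s), (drop i.+2 s).
rewrite /= -(drop_nth e0) // -(drop_nth e0) ?cat_take_drop //; exact: ltnW.
Qed.

(* [l v u w]: the edges [vu] and [vw] are linked at [v]. *)
Variable l : T -> T -> T -> bool.
Hypothesis lC : forall v u w, l v u w = l v w u.
Hypothesis l_inj : forall v u w w', l v u w -> l v u w' -> w = w'.
Hypothesis l_neq : forall v u w, l v u w -> u != w.

Fixpoint chained p :=
  if p is u :: ((v :: w :: _) as q) then l v u w && chained q else true.

Lemma chainedP x0 p :
  reflect (forall i, i.+2 < size p ->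
             l (nth x0 p i.+1) (nth x0 p i) (nth x0 p i.+2)) (chained p).
Proof.
elim: p => [|u [|v [|w p]] IHp]; try by constructor.
change (chained [:: u, v, w & p]) with (l v u w && chained [:: v, w & p]).
apply: (iffP andP) => [[luvw /IHp Hp] [|i] //= lti|Hp]; first exact: Hp.
by split; [apply: (Hp 0) | apply/IHp => i lti; apply: (Hp i.+1)].
Qed.

Lemma chained_rev p : chained (rev p) = chained p.
Proof.
suff imp q : chained q -> chained (rev q).
  by apply/idP/idP => /imp //; rewrite revK.
case: q => // x0 q; set r := x0 :: q.
move=> /(chainedP x0) Hr; apply/(chainedP x0) => i; rewrite size_rev => lti.
have lt1 := ltnW lti; have lt0 := ltnW lt1.
rewrite !nth_rev // lC.
have -> : size r - i.+1 = (size r - i.+3).+2 by lia.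
have -> : size r - i.+2 = (size r - i.+3).+1 by lia.
by apply: Hr; lia.
Qed.

Definition trail D p :=
  [&& 1 < size p, uniq (steps p), all (mem D) (steps p) & chained p].

Lemma trail_rev D p : trail D (rev p) = trail D p.
Proof. by rewrite /trail size_rev steps_rev rev_uniq all_rev chained_rev. Qed.

Lemma nth_step_inj x0 D p i j : trail D p -> i.+1 < size p -> j.+1 < size p ->
  [set nth x0 p i; nth x0 p i.+1] = [set nth x0 p j; nth x0 p j.+1] -> i = j.
Proof.
case/and4P=> _ Up _ _ lti ltj; rewrite -!(@nth_steps x0 set0) // => /eqP.
by rewrite nth_uniq ?size_steps ?ltn_predRL // => /eqP.
Qed.

Lemma mem_steps x0 p e : e \in steps p ->
  exists2 i, i.+1 < size p & e = [set nth x0 p i; nth x0 p i.+1].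
Proof.
case/(nthP set0)=> i; rewrite size_steps ltn_predRL => lti <-.
by exists i; rewrite // (nth_steps x0).
Qed.

Lemma step_mem x0 p i : i.+1 < size p ->
  [set nth x0 p i; nth x0 p i.+1] \in steps p.
Proof.
move=> lti; rewrite -(@nth_steps x0 set0) //.
by rewrite mem_nth // size_steps ltn_predRL.
Qed.

Section Decomposition.

Variable D : {set {set T}}.
Hypothesis D_neq : forall u v, [set u; v] \in D -> u != v.

Lemma step_neq x0 p i : trail D p -> i.+1 < size p ->
  nth x0 p i != nth x0 p i.+1.
Proof.
case/and4P=> _ _ /allP Dp _ lti.
by apply/D_neq/Dp/step_mem.
Qed.

(* An end of a trail is linked to an edge of the trail only by closing it. *)
Lemma trail_closed x0 p w : trail D p ->
  l (nth x0 p 0) (nth x0 p 1) w -> [set w; nth x0 p 0] \in steps p ->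
  nth x0 p (size p).-1 = nth x0 p 0 /\ nth x0 p (size p).-2 = w.
Proof.
move=> tp lw /(@mem_steps x0)[i lti E].
have /and4P[p1 _ _ /(chainedP x0) lp] := tp.
case: (set2_inj E) => [] [Ew E0].
  have [ltj|] := ltnP i.+2 (size p); last first.
    move=> gei; have -> : size p = i.+2 by lia.
    by rewrite /= -E0 -Ew.
  have e1 : nth x0 p i.+2 = nth x0 p 1.
    by apply: (@l_inj (nth x0 p 0) w); [rewrite {1}E0 Ew; exact: lp |
      rewrite lC].
  suff : i.+1 = 0 by [].
  apply: (nth_step_inj (x0 := x0) tp) => //.
  by rewrite e1 -E0 setUC.
case: i => [|i] in lti E Ew E0 *.
  by have := l_neq lw; rewrite Ew eqxx.
have ltj : i.+1 < size p by apply: ltnW.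
have e1 : nth x0 p i = nth x0 p 1.
  by apply: (@l_inj (nth x0 p 0) w); [rewrite {1}E0 Ew lC; exact: lp |
    rewrite lC].
have i0 : i = 0.
  apply: (nth_step_inj (x0 := x0) tp) => //.
  by rewrite e1 -E0 setUC.
by have := step_neq x0 tp ltj; rewrite -E0 i0 eqxx.
Qed.

(** By [l_inj] an edge has only one partner at [v], so inside the trail it is the neighbouring edge;
    the other two cases have [v] as an end of the trail. *)
Lemma trail_inner x0 p u v w : trail D p -> [set u; v] \in steps p ->
  l v u w ->
  [\/ consecutive (steps p) [set u; v] [set v; w],
      v = nth x0 p 0 /\ u = nth x0 p 1
    | v = nth x0 p (size p).-1 /\ u = nth x0 p (size p).-2].
Proof.
move=> tp /(@mem_steps x0)[i lti E] lw.
have /and4P[p1 _ _ /(chainedP x0) lp] := tp.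
case: (set2_inj E) => [] [Eu Ev].
  have [ltj|gei] := ltnP i.+2 (size p); last first.
    by constructor 3; have -> : size p = i.+2 by lia.
  constructor 1.
  have -> : w = nth x0 p i.+2.
    by apply: l_inj lw _; rewrite Eu Ev; apply: lp.
  rewrite Eu Ev -!(@nth_steps x0 set0) // /consecutive infix2_nth //.
  by rewrite size_steps ltn_predRL.
case: i => [|i] in lti E Eu Ev *; first by constructor 2.
constructor 1.
have ltj : i.+1 < size p by apply: ltnW.
have -> : w = nth x0 p i.
  by apply: l_inj lw _; rewrite Eu Ev lC; apply: lp.
rewrite Eu Ev setUC (setUC _ [set nth x0 p i]) -!(@nth_steps x0 set0) //.
by rewrite /consecutive infix2_nth ?orbT // size_steps ltn_predRL.
Qed.

Definition saturated_path p := forall u v w, [set u; v] \in steps p ->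
  l v u w -> consecutive (steps p) [set u; v] [set v; w].

(** The second clause records the link at the base point; it later yields the alternation between
    the last and the first edge. *)
Definition saturated_cycle x0 p :=
  [/\ nth x0 p (size p).-1 = nth x0 p 0,
      l (nth x0 p 0) (nth x0 p 1) (nth x0 p (size p).-2)
    & forall u v w, [set u; v] \in steps p -> l v u w ->
        cyclically_consecutive (steps p) [set u; v] [set v; w]].

Hypothesis D_closed : forall u v w, [set u; v] \in D -> l v u w ->
  [set v; w] \in D.

(** A partner of the first edge at the starting vertex must already be on the trail, since otherwise
    it would extend it; by [trail_closed] the trail then closes up. Without such a partner, reversal
    shows that the final vertex has none either. *)
Lemma maximal_trail p : trail D p -> (forall q, trail D q ->
  size q <= size p) ->
  saturated_path p \/ exists x0, saturated_cycle x0 p.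
Proof.
move=> tp maxp; have /and4P[p1 _ _ _] := tp.
have [x0 _] : exists x0 : T, true by case: (p) p1 => // x0; exists x0.
(* Stated for every trail of the maximal size, so that it serves both [p] and [rev p]. *)
have ends r w : trail D r -> size r = size p ->
    l (nth x0 r 0) (nth x0 r 1) w ->
    nth x0 r (size r).-1 = nth x0 r 0 /\ nth x0 r (size r).-2 = w.
  move=> tr szr lw; apply: trail_closed => //.
  apply: contraTT tr => nr; apply/negP => tr.
  suff /maxp : trail D (w :: r) by rewrite /= szr ltnn.
  case: r szr => [|y [|z r]] /= szr in tr lw nr *; try by rewrite -szr in p1.
  case/and4P: tr => _ /= Ur Dr cr; apply/and4P; split=> //=.
  - by rewrite nr.
  - rewrite Dr andbT setUC (D_closed _ lw) // setUC; by case/andP: Dr.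
  - by rewrite lC lw.
have last_rev i : i < size p -> nth x0 (rev p) i = nth x0 p ((size p).-1 - i).
  by move=> lti; rewrite nth_rev // -subn1 -subnDA add1n.
have last1 : (size p).-1 - 1 = (size p).-2 by lia.
case: (pickP (l (nth x0 p 0) (nth x0 p 1))) => [w lw|no0].
  have [e0 ew] := ends p w tp erefl lw.
  right; exists x0; split; rewrite // ?ew // => u v t uv lt.
  have cyc : cyclically_consecutive (steps p)
      [set nth x0 p 1; nth x0 p 0] [set nth x0 p 0; w].
    have szs : 0 < size (steps p) by rewrite size_steps ltn_predRL.
    have se : nth set0 (steps p) 0 = [set nth x0 p 0; nth x0 p 1].
      by rewrite (nth_steps x0).
    have sl : nth set0 (steps p) (size p).-2 = [set w; nth x0 p 0].
      rewrite (nth_steps x0); last by lia.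
      have -> : (size p).-2.+1 = (size p).-1 by lia.
      by rewrite ew e0.
    rewrite setUC (setUC [set _] [set w]) -se -sl /cyclically_consecutive.
    case Es : (steps p) szs => [|e s] // _.
    have szE : size (e :: s) = (size p).-1 by rewrite -Es size_steps.
    apply/orP; right.
    (* In [rcons (e :: s) e] the closing corner occupies the last two positions, the final one being
       the appended copy of the first edge. *)
    have -> : nth set0 (e :: s) 0 = nth set0 (rcons (e :: s) e) (size p).-2.+1.
      rewrite nth_rcons szE; have -> : (size p).-2.+1 = (size p).-1 by lia.
      by rewrite ltnn eqxx.
    have -> : nth set0 (e :: s) (size p).-2 = nth set0 (rcons (e ::
      s) e) (size p).-2.
      by rewrite nth_rcons szE ifT //; lia.
    by apply: infix2_nth; rewrite size_rcons szE; lia.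
  case: (trail_inner x0 tp uv lt) => [con|[ev eu]|[ev eu]].
  - rewrite /cyclically_consecutive; case: (steps p) con => // e s.
    by rewrite /consecutive => /orP[] con; apply/orP; [left|right];
       rewrite -cats1 infix_catr.
  - by rewrite ev eu in lt *; rewrite (l_inj lt lw).
  - rewrite ev eu e0 ew in lt *; rewrite lC in lw.
    rewrite (l_inj lt lw) (setUC [set w]) (setUC _ [set nth x0 p 1]).
    move: cyc; rewrite /cyclically_consecutive; case: (steps p) => // e s.
    by rewrite {1}/consecutive orbC.
left=> u v t uv lt; case: (trail_inner x0 tp uv lt) => // [] [ev eu].
  by rewrite ev eu no0 in lt.
have lt' : l (nth x0 (rev p) 0) (nth x0 (rev p) 1) t.
  by rewrite !last_rev ?(ltnW p1) // subn0 last1 -ev -eu.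
have tr : trail D (rev p) by rewrite trail_rev.
have [er1 er2] := ends _ t tr (size_rev p) lt'.
move: er1 er2; rewrite size_rev !last_rev; try by lia.
rewrite subn0 subnn => e0; have -> : (size p).-1 - (size p).-2 = 1 by lia.
move=> e1; move: lt; rewrite ev -e0 -e1 lC.
by rewrite no0.
Qed.

Hypothesis D_set2 : forall e, e \in D -> exists u v, e = [set u; v].

(** A single edge of [D] is a trail, and distinctness of edges bounds the number of vertices of a
    trail by [#|D|.+1]. *)
Lemma exists_maximal_trail : D != set0 ->
  exists2 p, trail D p & forall q, trail D q -> size q <= size p.
Proof.
case/set0Pn=> e De; have [u [v Ee]] := D_set2 De.
pose P n := [exists p : n.-tuple T, trail D p].
have P2 : exists n, P n.
  exists 2; apply/existsP; exists [tuple u; v].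
  by rewrite /trail /= -Ee De.
have trail_size q : trail D q -> size q <= #|D|.+1.
  case/and4P=> q1 Uq /allP Dq _.
  have -> : size q = (size (steps q)).+1 by rewrite size_steps; lia.
  by rewrite ltnS -(card_uniqP Uq); apply/subset_leq_card/subsetP.
have Pmax n : P n -> n <= #|D|.+1.
  by case/existsP=> p /trail_size; rewrite size_tuple.
case: (ex_maxnP P2 Pmax) => n /existsP[p tp] maxn.
exists p => // q tq; rewrite size_tuple; apply: maxn.
by apply/existsP; exists (in_tuple q).
Qed.

End Decomposition.

Lemma consecutive_mem s (e f : {set T}) : consecutive s e f -> f \in s.
Proof. by case/orP=> /mem_infix; apply; rewrite !inE eqxx ?orbT. Qed.

Lemma cyclically_consecutive_mem s (e f : {set T}) :
  cyclically_consecutive s e f -> f \in s.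
Proof.
case: s => // x s /consecutive_mem.
by rewrite mem_rcons inE => /orP[/eqP->|//]; rewrite inE eqxx.
Qed.

(** Induction on the size of [D]. The edge set of a saturated trail is closed under links, so by
    symmetry of [l] its complement in [D] is closed too. *)
Lemma trail_decomposition D :
  (forall u v, [set u; v] \in D -> u != v) ->
  (forall u v w, [set u; v] \in D -> l v u w -> [set v; w] \in D) ->
  (forall e, e \in D -> exists u v, e = [set u; v]) ->
  exists P, partition P D /\ forall B, B \in P ->
    exists p, [/\ B = [set:: steps p], trail D p &
      saturated_path p \/ exists x0, saturated_cycle x0 p].
Proof.
have [n] := ubnP #|D|; elim: n D => // n IHn D leDn D_neq D_closed D_set2.
have [->|nD0] := eqVneq D set0.
  exists set0; split=> [|B]; last by rewrite inE.
  apply/and3P; rewrite inE; split=> //; first by rewrite /cover big_set0.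
  by apply/trivIsetP => A B; rewrite inE.
have [p tp maxp] := exists_maximal_trail D_set2 nD0.
have sat := maximal_trail D_neq D_closed tp maxp.
have /and4P[p1 _ /allP Dp _] := tp.
set B0 := [set:: steps p].
have B0D : B0 \subset D by apply/subsetP => e; rewrite inE; apply: Dp.
have B0n0 : B0 != set0.
  case: (p) p1 @B0 {B0D} => [|x [|y q]] //= _.
  by apply/set0Pn; exists [set x; y]; rewrite !inE eqxx.
have sat_mem u v w : [set u; v] \in steps p -> l v u w -> [set v;
  w] \in steps p.
  case: sat => [sat|[x0 [_ _ sat]]] uv lw.
    exact: consecutive_mem (sat _ _ _ uv lw).
  exact: cyclically_consecutive_mem (sat _ _ _ uv lw).
have [|u v|u v w|e|P [partP HP]] := IHn (D :\: B0).
- by rewrite cardsDS // -ltnS (leq_trans _ leDn) // ltnS ltn_subrL !card_gt0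
  B0n0.
- by rewrite inE => /andP[_ /D_neq].
- rewrite !inE => /andP[nuv uv] lw; rewrite (D_closed _ _ _ uv lw) andbT.
  apply: contra nuv => vw; rewrite setUC; apply: (sat_mem w);
    first by rewrite setUC.
  by rewrite lC.
- by rewrite inE => /andP[_ /D_set2].
exists (B0 |: P); split.
  rewrite -(setID D B0) (setIidPr B0D); apply: partitionU1 => //.
  by rewrite -setI_eq0 setIDA setIC -setIDA setDv setI0.
move=> B /setU1P[->|/HP[q [-> tq satq]]]; first by exists p.
exists q; split=> //.
case/and4P: tq => q1 Uq /allP Dq cq; apply/and4P; split=> //.
by apply/allP => e /Dq/setDP[].
Qed.

End Trails.

(** * Amenability, and graphs without exceptional pentagons *)

(** This lets [linked_inj], which starts from an edge of the first colour, be used from the second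
    colour as well. *)
Lemma linkedC (T : finType) (a b c : rel T) v u w : symmetric a ->
  symmetric b ->
  symmetric c -> linked a b c v u w = linked b a c v w u.
Proof.
move=> aC bC cC; rewrite /linked andbCA (cC u) (aC u) (bC u).
by congr [&& _, _ & _ || _]; rewrite orbC.
Qed.

Lemma eq_set2 (T : finType) (a b c d : T) :
  ([set a; b] == [set c; d]) = (a == c) && (b == d) || (a == d) && (b == c).
Proof.
apply/eqP/orP => [/set2_inj[] [-> ->]|[] /andP[/eqP-> /eqP->]] //.
- by left; rewrite !eqxx.
- by right; rewrite !eqxx.
by rewrite setUC.
Qed.

Section Decomposition.

Variables (T : finType) (g : rel T).
Hypotheses (g_sym : symmetric g) (g_irr : irreflexive g).
Implicit Types (F H X Y : {set {set T}}).

Definition joined F : rel T := fun u v => [set u; v] \in F.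

Lemma joinedC F : symmetric (joined F).
Proof. by move=> u v; rewrite /joined setUC. Qed.

Lemma joined_adj F u v : F \subset edges g -> [set u; v] \in F -> g u v.
Proof.
move=> /subsetP sF /sF /imsetP[[x y]]; rewrite inE /= => gxy.
by case/set2_inj=> [] [-> ->] //; rewrite g_sym.
Qed.

Lemma two_matching_deg F u x y z : two_matching g F ->
  [set u; x] \in F -> [set u; y] \in F -> [set u; z] \in F ->
  [|| x == y, y == z | x == z].
Proof.
case=> /(joined_adj) adjF degF ux uy uz; apply: contraT.
rewrite !negb_or => /and3P[nxy nyz nxz].
have ne w : [set u; w] \in F -> (w == u) = false.
  by move/adjF => guw; apply: contraTF guw => /eqP->; rewrite g_irr.
have := degF u; rewrite leqNgt => /negP[].
have Us : uniq [:: [set u; x]; [set u; y]; [set u; z]].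
  rewrite /= !inE !eq_set2 !eqxx !ne //= ?andbF ?orbF.
  by rewrite negb_or nxy nxz nyz.
have <- : #|[:: [set u; x]; [set u; y]; [set u; z]]| = 3 by apply/card_uniqP.
apply/subset_leq_card/subsetP => e.
by rewrite !inE => /or3P[]/eqP->; rewrite ?ux ?uy ?uz !inE eqxx.
Qed.

Lemma tf_two_matchingF F x y z : tf_two_matching g F ->
  [set x; y] \in F -> [set y; z] \in F -> [set z; x] \in F -> False.
Proof.
case=> [[/joined_adj adjF _] tfF] xy yz zx.
have /tfF/negP[] : triangle g [set [set x; y]; [set y; z]; [set z; x]].
  by exists x, y, z; split; rewrite ?adjF.
by apply/subsetP => e; rewrite !inE -orbA => /or3P[]/eqP->.
Qed.

Variables M N : {set {set T}}.
Hypotheses (tfM : tf_two_matching g M) (tfN : tf_two_matching g N).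

Lemma M_adj u v : [set u; v] \in M -> g u v.
Proof. by case: tfM => [[/joined_adj + _] _]; apply. Qed.
Lemma N_adj u v : [set u; v] \in N -> g u v.
Proof. by case: tfN => [[/joined_adj + _] _]; apply. Qed.

Definition symdiff := (M :\: N) :|: (N :\: M).

(** Triangle-freeness excludes triangles inside [M] or inside [N]. What remains has one or two edges
    outside [M], and a corner between an [N]-edge of [p] and an [M]-edge is asked for; that the
    [M]-edges lie on [p] is not presupposed. *)
Lemma amenable_intro (consec : rel {set T}) p :
  {subset steps p <= symdiff} ->
  (forall q r s, [set q; r] \in steps p -> [set q; r] \notin M ->
     [set r; s] \in M -> [set s; q] \in M ->
     consec [set q; r] [set r; s] || consec [set q; r] [set s; q]) ->
  (forall q r s, [set q; r] \in steps p -> [set q; r] \notin M ->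
     [set r; s] \in steps p -> [set r; s] \notin M -> [set s; q] \in M ->
     consec [set q; r] [set s; q] || consec [set r; s] [set s; q]) ->
  amenable_for g consec M p.
Proof.
move=> sp H1 H2 t [x [y [z [gxy gyz gzx ->]]]] /subsetP st.
have neqg u v : g u v -> (u == v) = false.
  by move=> guv; apply: contraTF guv => /eqP->; rewrite g_irr.
have [[nxy nyz] nzx] := (neqg _ _ gxy, neqg _ _ gyz, neqg _ _ gzx).
have inP e : e \in [set [set x; y]; [set y; z]; [set z; x]] ->
    e \in M \/ [/\ e \in steps p, e \notin M & e \in N].
  move/st; rewrite !inE; case: (boolP (e \in M)) => [|nM /= es]; first by left.
  by right; split=> //; have := sp _ es; rewrite !inE (negPf nM) andbF.
have fin a b : consec a b -> a != b ->
    a \in [set [set x; y]; [set y; z]; [set z; x]] ->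
    b \in [set [set x; y]; [set y; z]; [set z; x]] ->
    exists a b, [/\ a \in [set [set x; y]; [set y; z]; [set z; x]],
     b \in [set [set x; y]; [set y; z]; [set z; x]], a != b & consec a b].
  by move=> cab nab at_ bt; exists a, b.
have ne : (([set x; y] == [set y; z]) = false) * (([set y; z] == [set x;
  y]) = false)
  * (([set y; z] == [set z; x]) = false) * (([set z; x] == [set y; z]) = false)
  * (([set x; y] == [set z; x]) = false) * (([set z; x] == [set x; y]) = false).
  by rewrite !eq_set2 nxy nyz nzx !(eq_sym x z) !(eq_sym y x) !(eq_sym z y)
     nxy nyz nzx !andbF.
have [xyt yzt zxt] : [/\ [set x; y] \in [set [set x; y]; [set y; z]; [set z;
  x]],
   [set y; z] \in [set [set x; y]; [set y; z]; [set z; x]] &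
   [set z; x] \in [set [set x; y]; [set y; z]; [set z; x]]].
  by rewrite !inE !eqxx !orbT.
case: (inP _ xyt) (inP _ yzt) (inP _ zxt) =>
  [xy|[xys xyM xyN]] [yz|[yzs yzM yzN]] [zx|[zxs zxM zxN]].
- by case: (tf_two_matchingF tfM xy yz zx).
- by case/orP: (H1 z x y zxs zxM xy yz) => h; apply: (fin _ _ h); rewrite ?ne.
- by case/orP: (H1 y z x yzs yzM zx xy) => h; apply: (fin _ _ h); rewrite ?ne.
- by case/orP: (H2 y z x yzs yzM zxs zxM xy) => h; apply: (fin _ _ h);
  rewrite ?ne.
- by case/orP: (H1 x y z xys xyM yz zx) => h; apply: (fin _ _ h); rewrite ?ne.
- by case/orP: (H2 z x y zxs zxM xys xyM yz) => h; apply: (fin _ _ h);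
  rewrite ?ne.
- by case/orP: (H2 x y z xys xyM yzs yzM zx) => h; apply: (fin _ _ h);
  rewrite ?ne.
by case: (tf_two_matchingF tfN xyN yzN zxN).
Qed.

Definition amenable_trail p :=
  (alternating_path g M p /\ amenable_path g M p) \/
  (alternating_cycle g M p /\ amenable_cycle g M p).

Definition decomposable X := exists P, partition P X /\
  forall B, B \in P -> exists p, B = [set:: steps p] /\ amenable_trail p.

(* The invariant under which edges are removed from the symmetric difference. *)
Definition triangle_closed X := forall p q r, [set p; q] \in X ->
  [set q; r] \in M :|: N -> [set r; p] \in M :|: N ->
  [set q; r] \in symdiff -> [set q; r] \in X.

(* The [F]-edges form the pentagon [u v y x z]; the [H]-edges form the path
   [y u x v z], which the edge [yz] may close to a second pentagon. *)
Definition pentagon F H X u v x y z :=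
  let a := joined (X :&: (F :\: H)) in let b := joined (X :&: (H :\: F)) in
  [/\ [&& a u v, a v y, a y x, a x z & a z u], b u x, b v x, b u y & b v z].

Section Linked.

Variable X : {set {set T}}.
Hypothesis sX : X \subset symdiff.
Hypothesis X_closed : triangle_closed X.
Hypothesis no_pentagonM : forall u v x y z, ~ pentagon M N X u v x y z.
Hypothesis no_pentagonN : forall u v x y z, ~ pentagon N M X u v x y z.

Let a := joined (X :&: (M :\: N)).
Let b := joined (X :&: (N :\: M)).
Let c := joined (M :&: N).
(** In [linked] the [M]-edge comes first; the trail construction needs a symmetric relation. *)
Let link v u w := linked a b c v u w || linked a b c v w u.

Let linkC v u w : link v u w = link v w u.
Proof. exact: orbC. Qed.

Let abF u v : a u v -> b u v = false.
Proof. by rewrite /a /b /joined !inE; case: (_ \in N); rewrite ?andbF. Qed.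
Let baF u v : b u v -> a u v = false.
Proof. by rewrite /a /b /joined !inE; case: (_ \in N); rewrite ?andbF. Qed.
Let acF u v : a u v -> c u v = false.
Proof. by rewrite /a /c /joined !inE; case: (_ \in N); rewrite ?andbF. Qed.
Let bcF u v : b u v -> c u v = false.
Proof. by rewrite /b /c /joined !inE; case: (_ \in M); rewrite ?andbF. Qed.

Let acM u v : a u v || c u v -> [set u; v] \in M.
Proof. by rewrite /a /c /joined !inE; case: (_ \in M); rewrite ?andbF. Qed.
Let bcN u v : b u v || c u v -> [set u; v] \in N.
Proof. by rewrite /b /c /joined !inE; case: (_ \in N); rewrite ?andbF. Qed.

Let airr : irreflexive a.
Proof.
move=> u; apply/negP => auu; have /M_adj : [set u; u] \in M by rewrite acM ?auu.
by rewrite g_irr.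
Qed.
Let birr : irreflexive b.
Proof.
move=> u; apply/negP => auu; have /N_adj : [set u; u] \in N by rewrite bcN ?auu.
by rewrite g_irr.
Qed.

Let link_inj v u w w' : link v u w -> link v u w' -> w = w'.
Proof.
have aux w1 w2 : linked a b c v u w1 -> linked a b c v w2 u -> False.
  by case/and3P=> /abF vu _ _ /and3P[_]; rewrite vu.
case: tfM tfN => [m2M _] [m2N _].
have degM x1 x2 x3 x4 : a x1 x2 || c x1 x2 -> a x1 x3 || c x1 x3 ->
   a x1 x4 || c x1 x4 -> [|| x2 == x3, x3 == x4 | x2 == x4].
  by move=> /acM h1 /acM h2 /acM h3; apply: two_matching_deg m2M h1 h2 h3.
have degN x1 x2 x3 x4 : b x1 x2 || c x1 x2 -> b x1 x3 || c x1 x3 ->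
   b x1 x4 || c x1 x4 -> [|| x2 == x3, x3 == x4 | x2 == x4].
  by move=> /bcN h1 /bcN h2 /bcN h3; apply: two_matching_deg m2N h1 h2 h3.
case/orP=> l1 /orP[] l2.
- apply: (linked_inj _ _ _ _ _ _ _ _ _ l1 l2) => //; try exact: joinedC.
  move=> u' v' x y z *; apply: (@no_pentagonM u' v' x y z); split=> //.
  exact/and5P.
- by case: (aux _ _ l1 l2).
- by case: (aux _ _ l2 l1).
- rewrite !(@linkedC _ a b) in l1 l2; try exact: joinedC.
  apply: (linked_inj _ _ _ _ _ _ _ _ _ l1 l2) => //; try exact: joinedC.
  move=> u' v' x y z *; apply: (@no_pentagonN u' v' x y z); split=> //.
  exact/and5P.
Qed.

Let link_neq v u w : link v u w -> u != w.
Proof.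
rewrite /link => luw; apply/eqP => e; move: luw.
by rewrite e orbb => /and3P[/abF->].
Qed.

Let link_X v u w : link v u w -> [set v; w] \in X.
Proof.
by case/orP=> /and3P[]; rewrite /a /b /joined !inE => /andP[? _] /andP[? _].
Qed.

Let link_alt v u w : link v u w -> ([set u; v] \in M) != ([set v; w] \in M).
Proof.
rewrite setUC; case/orP=> /and3P[].
  rewrite /a /b /joined !inE => /and3P[_ _ ->] /and3P[_ /negPf-> _] //.
by rewrite /a /b /joined !inE => /and3P[_ _ ->] /and3P[_ /negPf-> _].
Qed.

Let trail_alternating p : trail link X p -> alternating_path g M p.
Proof.
case/and4P=> p1 Up /allP Xp cp.
have [x0 _] : exists x0 : T, true by case: (p) p1 => // x0; exists x0.
rewrite /alternating_path p1 Up /=; apply/andP; split; apply/(sortedP _).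
- instantiate (1 := x0) => i lti.
  have /Xp/(subsetP sX) := step_mem x0 lti.
  by rewrite !inE => /orP[/andP[_ /M_adj]|/andP[_ /N_adj]].
- instantiate (1 := set0) => i; rewrite size_steps ltn_predRL => lti.
  rewrite !(nth_steps x0) ?(ltnW lti) //; apply: link_alt.
  by move/(chainedP _ x0): cp; apply.
Qed.

(** The parameter [consec] covers paths and cycles at once. If all edges of the triangle are in
    [symdiff], [pick_total] supplies a linked corner at one end of the base; if exactly one is
    common, the corner of the other two is linked outright; if both [M]-edges, or the only one, are
    common, [N] contains the triangle. *)
Let saturated_amenable (consec : rel {set T}) p : trail link X p ->
  (forall u v w, [set u; v] \in steps p -> link v u w ->
     consec [set u; v] [set v; w]) ->
  amenable_for g consec M p.
Proof.
case/and4P=> p1 Up /allP Xp' cp sat.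
have Xp e : e \in steps p -> e \in X by move/Xp'.
have stepN q r : [set q; r] \in steps p -> [set q; r] \notin M -> b q r.
  move=> qr nM; have XD : [set q; r] \in X := Xp _ qr; have := subsetP sX _ XD.
  by rewrite /b /joined !inE (negPf nM) !andbF /= => ->; rewrite XD.
have bN q r : b q r -> [set q; r] \in N.
  by move=> qr; apply: bcN; rewrite qr.
(* Triangle-closedness of [X] ensures that an [M]-edge of the triangle that is not common is still
   in [X], hence coloured by [a]. *)
have MP q r s : [set q; r] \in steps p -> [set r; s] \in M -> [set s;
  q] \in M :|: N ->
    a r s \/ c r s.
  move=> /Xp qr rs sq; rewrite /a /c /joined !inE rs.
  case rsN : ([set r; s] \in N); [by right|left]; rewrite /= ?andbT.
  by apply: (X_closed qr _ sq); rewrite !inE rs ?rsN.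
apply: (amenable_intro (consec := consec) (p := p)) =>
  [e /Xp/(subsetP sX) //|q r s qrp qrM rsM sqM|q r s qrp qrM rsp rsM sqM].
  have qr := stepN _ _ qrp qrM.
  have rqp : [set r; q] \in steps p by rewrite setUC.
  have rq : b r q by rewrite /b joinedC.
  have nqr : q != r by apply: contraTneq qr => ->; rewrite birr.
  have rs : a r s \/ c r s by apply: MP qrp rsM _; rewrite inE sqM.
  have qs : a q s \/ c q s.
    by apply: MP rqp _ _; [rewrite setUC|rewrite setUC inE rsM].
  case: qs rs => [qs|qs] [rs|rs].
  - have sr : a s r by rewrite /a joinedC.
    have sq : a s q by rewrite /a joinedC.
    case/orP: (@pick_total _ b a c q r s nqr) => pk; apply/orP.
      right; rewrite setUC (setUC [set s]); apply: sat => //.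
      by rewrite /link /linked qs qr sr pk !orbT.
    left; apply: sat => //.
    by rewrite /link /linked rs rq sq pk !orbT.
  - apply/orP; right; rewrite setUC (setUC [set s]); apply: sat => //.
    have sr : c s r by rewrite /c joinedC.
    by rewrite /link /linked qs qr sr !orbT.
  - apply/orP; left; apply: sat => //.
    have sq : c s q by rewrite /c joinedC.
    by rewrite /link /linked rs rq sq !orbT.
  - have rsN : [set r; s] \in N by rewrite bcN ?rs ?orbT.
    have sqN : [set s; q] \in N by rewrite setUC bcN ?qs ?orbT.
    by case: (tf_two_matchingF tfN (bN _ _ qr) rsN sqN).
have qr := stepN _ _ qrp qrM.
have rs := stepN _ _ rsp rsM.
have rqp : [set r; q] \in steps p by rewrite setUC.
have [rq sr] : b r q /\ b s r by rewrite /b joinedC (joinedC _ s).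
have qs : a q s \/ c q s.
  by apply: MP rqp _ _; [rewrite setUC|rewrite setUC inE bN ?orbT].
case: qs => qs; last first.
  have sqN : [set s; q] \in N by rewrite setUC bcN ?qs ?orbT.
  by case: (tf_two_matchingF tfN (bN _ _ qr) (bN _ _ rs) sqN).
have nqs : q != s by apply: contraTneq qs => ->; rewrite airr.
have sq : a s q by rewrite /a joinedC.
case/orP: (@pick_total _ a b c q s r nqs) => pk; apply/orP.
  left; rewrite setUC (setUC [set s]); apply: sat => //.
  by rewrite /link /linked qs qr sr pk !orbT.
right; apply: sat => //.
by rewrite /link /linked sq sr qr pk !orbT.
Qed.

Lemma decomposable_linked : decomposable X.
Proof.
have [|u v w _ /link_X//|e eX|P [partP HP]] :=
    trail_decomposition linkC link_inj link_neq (D := X).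
- move=> u v /(subsetP sX); rewrite !inE.
  by case/orP=> /andP[_ uv]; apply: contraTneq uv => ->; apply/negP;
    [move/M_adj|move/N_adj]; rewrite g_irr.
- have : e \in edges g.
    case: tfM tfN => [[/subsetP sM _] _] [[/subsetP sN _] _].
    have := subsetP sX _ eX; rewrite !inE.
    by case/orP=> /andP[_] => [/sM|/sN].
  by case/imsetP=> [[u v] _ ->]; exists u, v.
exists P; split=> // B /HP[p [-> tp sat]]; exists p; split=> //.
case: sat => [sat|[x0 [e0 l0 sat]]]; [left|right].
  split; [exact: trail_alternating | exact: saturated_amenable].
split; last exact: saturated_amenable.
have altp := trail_alternating tp.
rewrite /alternating_cycle altp /=.
have /and4P[p1 _ _ salt] := altp.
case: p => [|x [|y p]] // in tp e0 l0 altp p1 salt sat *.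
apply/andP; split.
  by apply/eqP; move: e0; rewrite /= (last_nth x0) => ->.
rewrite /= rcons_path; apply/andP; split; first exact: salt.
have -> : last [set x; y] (pairmap (fun u v => [set u; v]) y p) =
    [set nth x0 [:: x, y & p] (size p); nth x0 [:: x, y & p] (size p).+1].
  by rewrite -(@nth_steps _ x0 set0) //= (last_nth set0) size_pairmap.
move: (link_alt l0); rewrite /= in e0 *.
by rewrite (setUC [set y]) eq_sym setUC -e0.
Qed.

End Linked.

(** * Removing an exceptional pentagon *)

Definition pentagon_verts (u v x y z : T) := [set u; v; x; y; z].

Definition outside X (K : {set T}) := [set e in X | ~~ (e \subset K)].

Section Peel.

Variables F H X : {set {set T}}.
Hypotheses (mF : two_matching g F) (mH : two_matching g H).
Variables u v x y z : T.
Hypothesis pent : pentagon F H X u v x y z.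

Implicit Types p q r : T.

(** Nine of the ten pairs of vertices are edges and so distinct; [y] and [z] are distinct because
    [uy] and [uz] have different colours. *)
Lemma pentagon_facts :
  [/\ uniq [:: u; v; x; y; z],
      [/\ [set u; v] \in X, [set v; y] \in X, [set y; x] \in X,
          [set x; z] \in X & [set z; u] \in X],
      [/\ [set u; x] \in X, [set x; v] \in X, [set y; u] \in X
        & [set v; z] \in X],
      [/\ [set u; v] \in F :\: H, [set v; y] \in F :\: H, [set y; x] \in F :\:
        H,
          [set x; z] \in F :\: H & [set z; u] \in F :\: H]
    & [/\ [set u; x] \in H :\: F, [set x; v] \in H :\: F, [set y; u] \in H :\: F
        & [set v; z] \in H :\: F]].
Proof.
have irrF w : [set w; w] \in F = false.
  by apply/negP; case: mF => /joined_adj adjF _ /adjF; rewrite g_irr.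
have irrH w : [set w; w] \in H = false.
  by apply/negP; case: mH => /joined_adj adjF _ /adjF; rewrite g_irr.
case: pent => /and5P[]; rewrite /joined ![_ \in X :&: _]inE.
move=> /andP[uvX uv] /andP[vyX vy] /andP[yxX yx] /andP[xzX xz] /andP[zuX zu].
move=> /andP[uxX ux] /andP[vxX vx] /andP[uyX uy] /andP[vzX vz].
split; first last.
- by rewrite (setUC [set x]) (setUC [set y]).
- by [].
- by rewrite (setUC [set x]) (setUC [set y]).
- by [].
have loop p q : [set p; q] \in F \/ [set p; q] \in H -> (p == q) = false.
  by move=> pq; apply/eqP => e; move: pq; rewrite e irrF irrH => -[].
have neq_pq p q r : [set p; q] \in F :\: H -> [set p; r] \in H :\: F ->
  (q == r) = false.
  by rewrite !inE => /andP[_ pq] /andP[pr _]; apply: contraNF pr => /eqP<-.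
have inFH e : e \in F :\: H -> e \in F \/ e \in H by case/setDP; left.
have inHF e : e \in H :\: F -> e \in F \/ e \in H by case/setDP; right.
rewrite /= !inE !negb_or (loop u v) ?(loop u x) ?(loop u y) ?(loop u z) ?(loop
  v x)
  ?(loop v y) ?(loop v z) ?(loop x y) ?(loop x z) //=; auto.
- by rewrite eq_sym (neq_pq u z y) // setUC.
- by rewrite setUC; auto.
by rewrite setUC; auto.
Qed.

Let K := pentagon_verts u v x y z.

Let inK p : p \in K = (p \in [:: u; v; x; y; z]).
Proof. by rewrite !inE !orbA. Qed.

Let third q r1 r2 p : [set q; r1] \in F :\: H -> [set q; r2] \in F :\: H ->
  r1 != r2 -> [set q; p] \in F -> p = r1 \/ p = r2.
Proof.
move=> /setDP[q1 _] /setDP[q2 _] n12 qp.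
have := two_matching_deg mF q1 q2 qp.
by rewrite (negPf n12) /= => /orP[]/eqP->; auto.
Qed.

Let thirdH q r1 r2 p : [set q; r1] \in H :\: F -> [set q; r2] \in H :\: F ->
  r1 != r2 -> [set q; p] \in H -> p = r1 \/ p = r2.
Proof.
move=> /setDP[q1 _] /setDP[q2 _] n12 qp.
have := two_matching_deg mH q1 q2 qp.
by rewrite (negPf n12) /= => /orP[]/eqP->; auto.
Qed.

(** Each of [u], [v], [x] already has two [F]-edges and two [H]-edges inside the pentagon, so no
    edge leaves it there. *)
Lemma pentagon_neighbour p q : q \in [:: u; v; x] ->
  [set q; p] \in F :|: H -> p \in K.
Proof.
have [U _ _ [uv vy yx xz zu] [ux xv yu vz]] := pentagon_facts.
rewrite /= !inE !negb_or -!andbA in U.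
case/and5P: U =>
  nuv nux nuy nuz /and5P[nvx nvy nvz nxy /andP[nxz /andP[nyz _]]].
have [vu xy zx uz] : [/\ [set v; u] \in F :\: H, [set x; y] \in F :\: H,
  [set z; x] \in F :\: H & [set u; z] \in F :\: H].
  by rewrite [[set v; u]]setUC [[set x; y]]setUC [[set z; x]]setUC [[set u;
    z]]setUC.
have [uy vx xu] : [/\ [set u; y] \in H :\: F, [set v; x] \in H :\: F &
  [set x; u] \in H :\: F].
  by rewrite [[set u; y]]setUC [[set v; x]]setUC [[set x; u]]setUC.
rewrite inK !in_cons in_nil orbF => /or3P[]/eqP-> /setUP[] qp.
- by case: (third uv uz nvz qp) => ->; rewrite ?inE eqxx ?orbT.
- by case: (thirdH ux uy nxy qp) => ->; rewrite ?inE eqxx ?orbT.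
- by case: (third vu vy nuy qp) => ->; rewrite ?inE eqxx ?orbT.
- by case: (thirdH vx vz nxz qp) => ->; rewrite ?inE eqxx ?orbT.
- by case: (third xy xz nyz qp) => ->; rewrite ?inE eqxx ?orbT.
- by case: (thirdH xu xv nuv qp) => ->; rewrite ?inE eqxx ?orbT.
Qed.

(** The two [F]-edges at [y] go to [v] and [x]. *)
Lemma pentagon_chord : [set y; z] \in F :|: H -> [set y; z] \in H :\: F.
Proof.
have [U _ _ [uv vy yx xz zu] _] := pentagon_facts.
rewrite /= !inE !negb_or -!andbA in U.
case/and5P: U =>
  nuv nux nuy nuz /and5P[nvx nvy nvz nxy /andP[nxz /andP[nyz _]]].
have yv : [set y; v] \in F :\: H by rewrite setUC.
have nF : [set y; z] \notin F.
  apply/negP => /(third yv yx nvx) [] e; move: nvz nxz; by rewrite e eqxx.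
by rewrite !inE nF (negPf nF).
Qed.

(** Only the pair [y], [z] is not settled by [pentagon_neighbour]; then the chord is an [H]-edge and
    fills the last free place at [y]. *)
Lemma pentagon_third p q r : q \in K -> r \in K -> q != r ->
  [set q; r] \in F :|: H -> [set q; p] \in F :|: H -> [set r; p] \in F :|: H ->
  p \in K.
Proof.
move=> qK rK nqr qr qp rp.
case q3: (q \in [:: u; v; x]); first exact: pentagon_neighbour q3 qp.
case r3: (r \in [:: u; v; x]); first exact: pentagon_neighbour r3 rp.
have [U _ _ _ [ux xv yu vz]] := pentagon_facts.
rewrite /= !inE !negb_or -!andbA in U.
case/and5P: U =>
  nuv nux nuy nuz /and5P[nvx nvy nvz nxy /andP[nxz /andP[nyz _]]].
have [yq zq] : [set y; z] \in F :|: H /\ [set y; p] \in F :|: H.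
  move: qK rK q3 r3 nqr qr qp rp; rewrite !inK !in_cons !in_nil !orbF.
  do 3![case: (q == _) => //=]; do 3![case: (r == _) => //=].
  case/orP=> /eqP-> /orP[]/eqP->; rewrite ?eqxx // => _ _ _ //.
  by rewrite setUC.
have yz := pentagon_chord yq.
move: zq; have [U' _ _ [uv vy yx xz zu] _] := pentagon_facts.
have yv : [set y; v] \in F :\: H by rewrite setUC.
rewrite inK => /setUP[yp|yp].
  by case: (third yv yx nvx yp) => ->; rewrite ?inE eqxx ?orbT.
by case: (thirdH yu yz nuz yp) => ->; rewrite ?inE eqxx ?orbT.
Qed.

(** A triangle with one edge inside [K] lies inside [K], so removing the inner edges breaks no
    triangle apart. *)
Lemma outside_closed : F :|: H = M :|: N -> X \subset symdiff ->
  triangle_closed X -> triangle_closed (outside X K).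
Proof.
move=> FH sX Xcl p q r.
rewrite !(in_set (fun e => (e \in X) && ~~ (e \subset K))).
case/andP=> pqX npq qr rp qrs; rewrite (Xcl p q r pqX qr rp qrs) /=.
apply: contra npq => /subsetP qrK.
have [qK rK] : q \in K /\ r \in K by split; apply: qrK; rewrite !inE eqxx ?orbT.
have nqr : q != r.
  apply: contraTneq qr => ->; rewrite inE.
  by apply/negP => /orP[/M_adj|/N_adj]; rewrite g_irr.
have pq : [set q; p] \in F :|: H.
  by rewrite FH setUC; have := subsetP sX _ pqX; rewrite !inE =>
    /orP[] /andP[_ ->];
    rewrite ?orbT.
have pK : p \in K.
  by apply: (pentagon_third qK rK) => //; rewrite FH // setUC.
by apply/subsetP => w /set2P[] ->.
Qed.

Definition pentagon_edges :=
  [:: [set u; v]; [set v; y]; [set y; x]; [set x; z]; [set z; u];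
      [set u; x]; [set x; v]; [set y; u]; [set v; z]].

Lemma inside_pentagon p q : p != q -> p \in K -> q \in K ->
  ([set p; q] \in pentagon_edges) || ([set p; q] == [set y; z]).
Proof.
rewrite !inK !in_cons !in_nil !orbF.
by move=> npq /or4P[|||/orP[]]/eqP ep /or4P[|||/orP[]]/eqP eq; move: npq;
  rewrite ep eq ?eqxx // !eq_set2 !eqxx ?orbT.
Qed.

Lemma pentagon_split : X \subset F :|: H ->
  X = [set:: pentagon_edges] :|: (X :&: [set [set y; z]]) :|: outside X K.
Proof.
move=> sX; have [_ [? ? ? ? ?] [? ? ? ?] _ _] := pentagon_facts.
apply/setP => e; rewrite !in_setU (in_set (fun e =>
  (e \in X) && ~~ (e \subset K))).
rewrite in_setI in_set1 [e \in [set:: _]]inE.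
case eX : (e \in X); last first.
  rewrite /= !orbF; apply/esym; apply: contraFF eX.
  rewrite /pentagon_edges !in_cons in_nil.
  by do 9![case/orP=> [/eqP-> //|]].
case eK: (e \subset K); last by rewrite orbT.
rewrite orbF; apply/esym.
have [p [q [npq Ee]]] : exists p q, p != q /\ e = [set p; q].
  have := subsetP sX _ eX; case/setUP => eF.
    case: mF => sF _; have := subsetP sF _ eF; case/imsetP=> [[p q]] /=.
    rewrite inE /= => gpq Ee; exists p, q; split=> //.
    by apply: contraTneq gpq => ->; rewrite g_irr.
  case: mH => sF _; have := subsetP sF _ eF; case/imsetP=> [[p q]] /=.
  rewrite inE /= => gpq Ee; exists p, q; split=> //.
  by apply: contraTneq gpq => ->; rewrite g_irr.
rewrite Ee; apply: inside_pentagon => //; move/subsetP: eK; apply;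
  by rewrite Ee !inE eqxx ?orbT.
Qed.

End Peel.

(** * Explicit trails of an exceptional pentagon *)

Lemma decomposable_cat ps Y : {in ps, forall p, amenable_trail p} ->
  uniq (flatten (map (@steps T) ps)) ->
  {in flatten (map (@steps T) ps), forall e, e \notin Y} -> decomposable Y ->
  decomposable ([set:: flatten (map (@steps T) ps)] :|: Y).
Proof.
elim: ps => [|p ps IHps] am U dY decY.
  by rewrite /= set_nil set0U.
move: U; rewrite /= cat_uniq => /and3P[Up /hasPn npps Ups].
have [q|e eps|//|P [partP HP]] := IHps _ Ups.
- by move=> qps; apply: am; rewrite inE qps orbT.
- by apply: dY; rewrite /= mem_cat eps orbT.
exists ([set:: steps p] |: P); split.
  have -> : [set:: steps p ++ flatten (map (@steps T) ps)] :|: Y =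
    [set:: steps p] :|: ([set:: flatten (map (@steps T) ps)] :|: Y).
    by apply/setP => e; rewrite !inE mem_cat orbA.
  apply: partitionU1 => //.
    have : 1 < size p.
      by case: (am p (mem_head _ _)) => [[/and4P[]]|[/and3P[/and4P[]]]].
    case: (p) => [|a [|b q]] // _.
    by apply/set0Pn; exists [set a; b]; rewrite !inE eqxx.
  rewrite -setI_eq0; apply/eqP/setP => e; rewrite !inE.
  apply/negP => /andP[ep /orP[eps|eY]].
    by have := npps _ eps; rewrite ep.
  by have := dY e; rewrite /= mem_cat ep eY => /(_ isT).
move=> B /setU1P[->|/HP//]; exists p; split=> //.
by apply: am; rewrite mem_head.
Qed.

Lemma uniq5_neq (u v x y z : T) : uniq [:: u; v; x; y; z] ->
  ((u == v) = false) * ((u == x) = false) * ((u == y) = false) *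
  ((u == z) = false) * ((v == x) = false) * ((v == y) = false) *
  ((v == z) = false) * ((x == y) = false) * ((x == z) = false) *
  ((y == z) = false) * ((v == u) = false) * ((x == u) = false) *
  ((y == u) = false) * ((z == u) = false) * ((x == v) = false) *
  ((y == v) = false) * ((z == v) = false) * ((y == x) = false) *
  ((z == x) = false) * ((z == y) = false).
Proof.
rewrite /= !inE !negb_or -!andbA.
case/and5P=> /negPf uv /negPf ux /negPf uy /negPf uz.
case/and5P=>
  /negPf vx /negPf vy /negPf vz /negPf xy /and3P[/negPf xz /negPf yz _].
by do !split; rewrite // eq_sym.
Qed.

Lemma M_edge p q : [set p; q] \in M :\: N ->
  ([set p; q] \in M) * ([set q; p] \in M) *
  ([set p; q] \in symdiff) * ([set q; p] \in symdiff) * g p q * g q p.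
Proof.
move=> pq; rewrite !(setUC [set q]) /symdiff (in_setU [set p; q]) pq.
by case/setDP: pq => pq _; rewrite (g_sym q) (M_adj pq) pq.
Qed.

Lemma N_edge p q : [set p; q] \in N :\: M ->
  (([set p; q] \in M) = false) * (([set q; p] \in M) = false) *
  ([set p; q] \in symdiff) * ([set q; p] \in symdiff) * g p q * g q p.
Proof.
move=> pq; rewrite !(setUC [set q]) /symdiff (in_setU [set p; q]) pq orbT.
by case/setDP: pq => /N_adj pq /negPf->; rewrite (g_sym q) pq.
Qed.

Lemma M_neighbour a b c s : [set a; b] \in M -> [set a; c] \in M ->
  (b == c) = false -> [set a; s] \in M -> (s == b) || (s == c).
Proof.
case: tfM => mM _ ab ac nbc as_; have := two_matching_deg mM ab ac as_.
by rewrite nbc /= !(eq_sym s) orbC.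
Qed.

(** When no two [N]-edges of the trail meet, the case of [amenable_intro] with two edges outside [M]
    degenerates to a loop. *)
Lemma amenable_disjointN p : all (fun e => e \in symdiff) (steps p) ->
  alternating_path g M p ->
  (forall q r s, [set q; r] \in steps p -> [set q; r] \notin M ->
     [set r; s] \in steps p -> [set r; s] \notin M -> q = s) ->
  (forall q r s, [set q; r] \in steps p -> [set q; r] \notin M ->
     [set r; s] \in M -> [set q; s] \in M ->
     consecutive (steps p) [set q; r] [set r; s] ||
     consecutive (steps p) [set q; r] [set s; q]) ->
  amenable_trail p.
Proof.
move=> /allP sp ap disj cons; left; split=> //; apply: amenable_intro => //.
  by move=> q r s qr qrM rs sq; apply: cons => //; rewrite setUC.
move=> q r s qr qrM rs rsM sq; have /M_adj := sq.
by rewrite (disj q r s) // g_irr.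
Qed.

(** [C] collects colours, [E] disequalities. Each [N]-edge of the trail must have an end among the
    three vertices whose [M]-neighbours [Mu], [Mv], [Mx] list; this leaves two candidates for the
    apex of a triangle. *)
Ltac pentagon_trail C E Mu Mv Mx :=
  apply: amenable_disjointN;
  [ by rewrite /= ?C
  | by rewrite /alternating_path /= ?inE ?eq_set2 ?C ?E ?eqxx ?(andbF, orbF,
    andbT)
  | move=> q r s; rewrite /= !inE; do ?[case/orP];
    move=> /eqP/set2_inj[] [-> ->]; rewrite ?C // => _;
    rewrite ?eq_set2 ?E ?eqxx ?(andbF, orbF, andbT) //=;
    do ?[case/orP]; move=> /eqP->; by rewrite ?C
  | move=> q r s; rewrite /= !inE; do ?[case/orP];
    move=> /eqP/set2_inj[] [-> ->]; rewrite ?C // => _;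
    let rs := fresh in let qs := fresh in let H := fresh in move=> rs qs;
    first [ have H := Mu _ rs | have H := Mv _ rs | have H := Mx _ rs
          | have H := Mu _ qs | have H := Mv _ qs | have H := Mx _ qs ];
    move: rs qs; case/orP: H => /eqP->; rewrite ?C // => _ _;
    by rewrite /consecutive /= ?eq_set2 ?E ?eqxx ?(andbF, orbF, andbT, orbT) ].

Ltac pentagon_cover E :=
  split;
  [ by move=> p; rewrite !inE => /or3P[]/eqP->
  | by rewrite /= ?inE ?eq_set2 ?E ?eqxx ?(andbF, orbF, andbT)
  | move=> e; rewrite /= ?inE ].

Definition chord (y z : T) :=
  if [set y; z] \in M :|: N then [:: [set y; z]] else [::].

(** The [N]-edges form the path [y u x v z], possibly closed by the chord, and are distributed so
    that any two that meet lie in different trails. *)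
Lemma pentagonM_trails X u v x y z : pentagon M N X u v x y z -> exists ps,
  [/\ {in ps, forall p, amenable_trail p}, uniq (flatten (map (@steps T) ps))
    & flatten (map (@steps T) ps) =i pentagon_edges u v x y z ++ chord y z].
Proof.
move=> pent; case: tfM tfN => [mM _] [mN _].
have [/uniq5_neq E _ _ [uv vy yx xz zu] [ux xv yu vz]] :=
  pentagon_facts mM mN pent.
pose C0 := (M_edge uv, M_edge vy, M_edge yx, M_edge xz, M_edge zu,
  N_edge ux, N_edge xv, N_edge yu, N_edge vz).
have My s : [set y; s] \in M -> (s == v) || (s == x).
  by apply: M_neighbour; rewrite ?C0 ?E.
have yzM : (([set y; z] \in M) = false) * (([set z; y] \in M) = false).
  rewrite (setUC [set z]); have : ([set y; z] \in M) = false.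
    by apply/negbTE/negP => /My; rewrite !E.
  by move->.
pose C := (C0, yzM).
have Mu s : [set u; s] \in M -> (s == v) || (s == z) by apply: M_neighbour;
  rewrite ?C ?E.
have Mv s : [set v; s] \in M -> (s == u) || (s == y) by apply: M_neighbour;
  rewrite ?C ?E.
have Mx s : [set x; s] \in M -> (s == y) || (s == z) by apply: M_neighbour;
  rewrite ?C ?E.
have am2 : amenable_trail [:: y; v; x; z] by pentagon_trail C E Mu Mv Mx.
have am3 : amenable_trail [:: y; u; v; z] by pentagon_trail C E Mu Mv Mx.
rewrite /chord; case: ifP => [/(pentagon_chord mM mN pent)/N_edge yzC|_].
  (* This closed trail is used as a path: no corner at [z] is needed. For the [N]-edge [yz] the
     [M]-neighbours of [y] replace those of [v]. *)
  have am1 : amenable_trail [:: z; u; x; y; z].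
    pose C' := (C, yzC).
    by pentagon_trail C' E Mu My Mx.
  exists [:: [:: z; u; x; y; z]; [:: y; v; x; z]; [:: y; u; v; z]].
  pentagon_cover E.
  rewrite (setUC [set x] [set y]) (setUC [set y] [set v]) (setUC [set v] [set
    x]).
  by do 10![case: (e == _) => //=].
have am1 : amenable_trail [:: z; u; x; y] by pentagon_trail C E Mu Mv Mx.
exists [:: [:: z; u; x; y]; [:: y; v; x; z]; [:: y; u; v; z]].
pentagon_cover E.
rewrite (setUC [set x] [set y]) (setUC [set y] [set v]) (setUC [set v] [set x]).
by do 9![case: (e == _) => //=].
Qed.

(** The [N]-edges now form an odd cycle, so keeping meeting ones apart takes three trails, one being
    the single edge [uz]. That edge lies in no triangle with two [M]-edges, as neither [xz] nor [yz]
    is in [M]. *)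
Lemma pentagonN_trails X u v x y z : pentagon N M X u v x y z ->
  [set y; z] \notin M :|: N -> exists ps,
  [/\ {in ps, forall p, amenable_trail p}, uniq (flatten (map (@steps T) ps))
    & flatten (map (@steps T) ps) =i pentagon_edges u v x y z ++ chord y z].
Proof.
move=> pent nyz; case: tfM tfN => [mM _] [mN _].
have [/uniq5_neq E _ _ [uv vy yx xz zu] [ux xv yu vz]] :=
  pentagon_facts mN mM pent.
have yzM : (([set y; z] \in M) = false) * (([set z; y] \in M) = false).
  by rewrite (setUC [set z]); move: nyz; rewrite inE negb_or => /andP[/negPf->
    _].
pose C := (N_edge uv, N_edge vy, N_edge yx, N_edge xz, N_edge zu,
  M_edge ux, M_edge xv, M_edge yu, M_edge vz, yzM).
have Mu s : [set u; s] \in M -> (s == x) || (s == y) by apply: M_neighbour;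
  rewrite ?C ?E.
have Mv s : [set v; s] \in M -> (s == x) || (s == z) by apply: M_neighbour;
  rewrite ?C ?E.
have Mx s : [set x; s] \in M -> (s == u) || (s == v) by apply: M_neighbour;
  rewrite ?C ?E.
have am1 : amenable_trail [:: z; x; v; y; u] by pentagon_trail C E Mu Mv Mx.
have am2 : amenable_trail [:: y; x; u; v; z] by pentagon_trail C E Mu Mv Mx.
have am3 : amenable_trail [:: u; z] by pentagon_trail C E Mu Mv Mx.
exists [:: [:: z; x; v; y; u]; [:: y; x; u; v; z]; [:: u; z]].
rewrite /chord (negPf nyz); pentagon_cover E.
rewrite (setUC [set z] [set x]) (setUC [set x] [set u]) (setUC [set u] [set z]).
by do 9![case: (e == _) => //=].
Qed.

(* If [M] closes the path, the roles of the colours can be exchanged. *)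
Lemma pentagon_rotate X u v x y z : pentagon N M X u v x y z ->
  [set y; z] \in X :&: (M :\: N) -> pentagon M N X y u v x z.
Proof.
case=> /and5P[uv vy yx xz zu] ux vx uy vz yz.
by split; rewrite /joined ?uv //; try (apply/and5P; split); rewrite // setUC.
Qed.

(** * Induction on the set of remaining edges *)

Definition has_pentagon F H X : bool :=
  [exists u, exists v, exists x, exists y, exists z,
    [&& [&& joined (X :&: (F :\: H)) u v, joined (X :&: (F :\: H)) v y,
         joined (X :&: (F :\: H)) y x, joined (X :&: (F :\: H)) x z
         & joined (X :&: (F :\: H)) z u], joined (X :&: (H :\: F)) u x,
     joined (X :&: (H :\: F)) v x, joined (X :&: (H :\: F)) u y
     & joined (X :&: (H :\: F)) v z]].

Lemma has_pentagonP F H X :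
  reflect (exists u v x y z, pentagon F H X u v x y z) (has_pentagon F H X).
Proof.
apply: (iffP idP).
  case/existsP=> u /existsP[v /existsP[x /existsP[y /existsP[z /and5P[*]]]]].
  by exists u, v, x, y, z.
case=> [u [v [x [y [z [p1 p2 p3 p4 p5]]]]]].
apply/existsP; exists u; apply/existsP; exists v; apply/existsP; exists x.
by apply/existsP; exists y; apply/existsP; exists z; apply/and5P.
Qed.

Lemma decomposable_outside F H X u v x y z :
  two_matching g F -> two_matching g H -> F :|: H = M :|: N ->
  H :\: F \subset symdiff ->
  pentagon F H X u v x y z -> X \subset symdiff -> triangle_closed X ->
  (exists ps, [/\ {in ps, forall p, amenable_trail p},
    uniq (flatten (map (@steps T) ps))
    & flatten (map (@steps T) ps) =i pentagon_edges u v x y z ++ chord y z]) ->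
  decomposable (outside X (pentagon_verts u v x y z)) -> decomposable X.
Proof.
move=> mF mH FH sHF pent sX Xcl [ps [am Ups eps]] dec.
have sXF : X \subset F :|: H.
  rewrite FH; apply: subset_trans sX _.
  by apply/subsetP => e; rewrite !inE => /orP[]/andP[_ ->]; rewrite ?orbT.
have [_ [_ _ yxX xzX zuX] [_ _ yuX vzX] _ _] := pentagon_facts mF mH pent.
(* An existing chord closes the triangle [u y z], whose edge [uy] is in [X], so triangle-closedness
   puts the chord into [X]. *)
have yzX : ([set y; z] \in X) = ([set y; z] \in M :|: N).
  rewrite -FH; apply/idP/idP => [/(subsetP sXF)//|yz].
  apply: (Xcl u); first by rewrite setUC.
  - by rewrite -FH.
  - by rewrite -FH; apply: (subsetP sXF).
  by apply: (subsetP sHF); apply: (pentagon_chord mF mH pent).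
have chordX : [set:: chord y z] = X :&: [set [set y; z]].
  apply/setP => e; rewrite in_setI in_set1 /chord -yzX [e \in [set:: _]]inE.
  by case: ifP => yz; rewrite ?inE; case: eqP => [->|_]; rewrite ?yz ?andbF.
rewrite (pentagon_split mF mH pent sXF) -chordX.
have -> : [set:: pentagon_edges u v x y z] :|: [set:: chord y z] =
  [set:: flatten (map (@steps T) ps)].
  by apply/setP => e; rewrite in_setU ![e \in [set:: _]]inE eps mem_cat.
apply: decomposable_cat => // e; rewrite eps => ein.
rewrite (in_set (fun e => (e \in X) && ~~ (e \subset _))) negb_and negbK.
apply/orP; right; move: ein; rewrite mem_cat => /orP[|].
  rewrite /pentagon_edges !in_cons in_nil.
  by do 9![case/orP=> [/eqP->|];
    first by rewrite subUset !sub1set !inE !eqxx ?orbT].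
rewrite /chord; case: ifP => // _; rewrite inE => /eqP->.
by rewrite subUset !sub1set !inE !eqxx ?orbT.
Qed.

(** Strong induction on [#|X|]: pentagons of colour [M] are removed first, then those of colour [N],
    and a set without either is handled by links. *)
Lemma decomposable_closed X : X \subset symdiff -> triangle_closed X ->
  decomposable X.
Proof.
case: (tfM) (tfN) => [mM _] [mN _].
have [n] := ubnP #|X|; elim: n X => // n IHn X ltXn sX Xcl.
have peel F H u v x y z : two_matching g F -> two_matching g H ->
    F :|: H = M :|: N -> pentagon F H X u v x y z ->
    decomposable (outside X (pentagon_verts u v x y z)).
  move=> mF mH FH pent; apply: IHn.
  - rewrite -ltnS (leq_trans _ ltXn) // ltnS; apply: proper_card.
    apply/properP; split; first by apply/subsetP => e; rewrite inE => /andP[].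
    have [_ [uvX _ _ _ _] _ _ _] := pentagon_facts mF mH pent.
    exists [set u; v] => //.
    by rewrite inE uvX /= negbK subUset !sub1set !inE !eqxx ?orbT.
  - by apply: subset_trans sX; apply/subsetP => e; rewrite inE => /andP[].
  exact: (outside_closed mF mH pent FH).
have [sMN sNM] : M :\: N \subset symdiff /\ N :\: M \subset symdiff.
  by rewrite subsetUl subsetUr.
case: (has_pentagonP M N X) => [[u [v [x [y [z pent]]]]]|noM].
  apply: (decomposable_outside mM mN _ sNM pent) => //.
    exact: pentagonM_trails pent.
  exact: (peel M N).
case: (has_pentagonP N M X) => [[u [v [x [y [z pent]]]]]|noN].
  have NM := setUC N M.
  apply: (decomposable_outside mN mM _ sMN pent) => //.
    (* A chord would be an [M]-edge completing a second pentagon, this time of colour [M], contrary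
       to [noM]. *)
    apply: (pentagonN_trails pent); apply/negP; rewrite -NM => yz; case: noM.
    exists y, u, v, x, z; apply: (pentagon_rotate pent).
    have yzM := pentagon_chord mN mM pent yz; rewrite inE yzM andbT.
    have [_ [_ _ _ _ zuX] [_ _ yuX _] _ _] := pentagon_facts mN mM pent.
    apply: (Xcl u); rewrite -?NM //; first by rewrite setUC.
      by have := subsetP sX _ zuX; rewrite !inE => /orP[] /andP[_ ->];
        rewrite ?orbT.
    exact: (subsetP sMN).
  exact: (peel N M).
apply: decomposable_linked => // u v x y z pent.
  by apply: noM; exists u, v, x, y, z.
by apply: noN; exists u, v, x, y, z.
Qed.

End Decomposition.

Theorem theorem1 (T : finType) (g : rel T)
  (g_sym : symmetric g) (g_irr : irreflexive g)
  (M N : {set {set T}})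
  (tfM : tf_two_matching g M) (tfN : tf_two_matching g N) :
  exists P : {set {set {set T}}},
    partition P ((M :\: N) :|: (N :\: M)) /\
    (forall B : {set {set T}}, B \in P ->
       exists p : seq T,
         B = [set:: steps p] /\
         ((alternating_path g M p /\ amenable_path g M p) \/
          (alternating_cycle g M p /\ amenable_cycle g M p))).
(* For the full symmetric difference, triangle-closedness is immediate from its last premise. *)
Proof. exact: (decomposable_closed g_sym g_irr tfM tfN). Qed.
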